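(* Let $\mu$ be a classification problem with Bayes regressor $f^*$, and let $\mathrm{Err}^*:=\frac12\min_{q\in\mathcal Q_k}\sum_{a\in[m]}W_1(r^*_a,q)$ with $r^*_a:=f^*\sharp(\mu^X_a\times\{a\})$. Let $\tilde f:\mathcal X\times\mathcal A\to\Delta_k$ be any deterministic measurable predictor, $\tilde r_a:=\tilde f\sharp(\mu^X_a\times\{a\})$, let $\tilde q\in\arg\min_{q\in\mathcal Q_k}\sum_{a}W_1(\tilde r_a,q)$, and for each $a$ let $T_a:\Delta_k\to\mathcal Y$ be the randomized function induced by an optimal coupling $\tilde\gamma_a\in\Gamma(\tilde r_a,\tilde q)$ for the cost $\|s-y\|_1$ (Markov kernel $K_a(s,B)=\tilde\gamma_a(B\mid s)$). Let $\bar h(x,a)=T_a(\tilde f(x,a))$. Then $$0\le\sum_{a\in[m]}\mathrm{Err}_a(\bar h)-\mathrm{Err}^*\le\sum_{a\in[m]}\mathbb E_{X\sim\mu^X_a}\big[\|\tilde f(X,a)-f^*(X,a)\|_1\big].$$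
   Context: Setup. $\mathcal X$ is a standard Borel space, $k\ge 2$, $\mathcal Y=\{e_1,\dots,e_k\}\subset\mathbb R^k$ is the set of standard basis vectors (one-hot labels), and $\mathcal A=[m]=\{1,\dots,m\}$. A classification problem is a probability distribution $\mu$ of a triple $(X,Y,A)$ on $\mathcal X\times\mathcal Y\times\mathcal A$ with $\mathbb P(A=a)>0$ for every $a$; $\mu_a$ is $\mu$ conditioned on $A=a$ and $\mu^X_a$ is the law of $X$ under $\mu_a$. A randomized function is given by a Markov kernel $K$ with $\mathbb P(f(u)\in B)=K(u,B)$, its randomness independent of $(X,Y,A)$. For a classifier $h:\mathcal X\times\mathcal A\to\mathcal Y$, $\mathrm{Err}_a(h):=\mathbb P(h(X,a)\neq Y\mid A=a)$. $\Delta_k=\{x\in\mathbb R^k:x\ge0,\ \sum_i x_i=1\}$. The Bayes regressor is $f^*(x,a)=\mathbb E_\mu[Y\mid X=x,A=a]\in\Delta_k$; $g\sharp(\mu^X_a\times\{a\})$ is the law of $g(X,a)$ for $X\sim\mu^X_a$. $\mathcal Q_k$ is the set of probability distributions supported on $\mathcal Y$. $\Gamma(p,q)$ is the set of couplings of $p$ and $q$, and $W_1(p,q)=\inf_{\gamma\in\Gamma(p,q)}\int\|s-s'\|_1\,d\gamma(s,s')$. *)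

(* Defs.v *)
From HB Require Import structures.
From mathcomp Require Import all_boot all_order all_algebra.
From mathcomp Require Import all_classical all_reals all_analysis.
Set Implicit Arguments. Unset Strict Implicit. Unset Printing Implicit Defensive.
Import Order.TTheory GRing.Theory Num.Theory.
Local Open Scope classical_set_scope.
Local Open Scope ring_scope.

HB.instance Definition _ (n : nat) := isPointed.Build 'I_n.+1 ord0.
HB.instance Definition _ (n : nat) := @isMeasurable.Build default_measure_display
  'I_n.+1 discrete_measurable discrete_measurable0
  discrete_measurableC discrete_measurableU.

Section defs.
Context {R : realType}.

(* R^k with its Borel (= product) sigma-algebra *)
Definition vec (k : nat) : measurableType _ := k.-tuple R.

Definition onehot {k : nat} (i : 'I_k) : vec k :=
  [tuple (i == j)%:R | j < k].

Definition Ylabels {k : nat} : set (vec k) := range (@onehot k).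

Definition l1 {k : nat} (s t : vec k) : R :=
  \sum_(j < k) `|tnth s j - tnth t j|.

Definition in_simplex {k : nat} (s : vec k) : Prop :=
  (forall j, 0 <= tnth s j) /\ \sum_(j < k) tnth s j = 1.

Local Open Scope ereal_scope.

Definition coupling {k : nat} (p q : set (vec k) -> \bar R)
    (g : probability (vec k * vec k)%type R) : Prop :=
  forall A : set (vec k), measurable A ->
    g (A `*` setT) = p A /\ g (setT `*` A) = q A.

Definition W1 {k : nat} (p q : set (vec k) -> \bar R) : \bar R :=
  ereal_inf [set \int[g]_z (l1 z.1 z.2)%:E | g in coupling p q].

Definition Qk {k : nat} : set (probability (vec k) R) :=
  [set q | q (@Ylabels k) = 1].

Definition standard_borel {d} (X : measurableType d) : Prop :=
  exists phi : X -> R,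
    measurable_fun setT phi /\ injective phi /\ measurable (range phi) /\
    (forall A : set X, measurable A -> measurable (phi @` A)).

(* A classification problem: mu is the law of (X, (Y, A)) on
   X * ('I_k * 'I_m); label index j stands for the one-hot vector e_j. *)
Section problem.
Context {d : measure_display} {X : measurableType d} {k m : nat}.
Variable mu : probability (X * ('I_k.+1 * 'I_m.+1))%type R.

Definition eventA (a : 'I_m.+1) : set (X * ('I_k.+1 * 'I_m.+1)) :=
  [set z | z.2.2 = a].

Definition cond_mu (a : 'I_m.+1) : set (X * ('I_k.+1 * 'I_m.+1)) -> \bar R :=
  fun B => mu (B `&` eventA a) * ((fine (mu (eventA a)))^-1)%:E.

Definition muX (a : 'I_m.+1) : set X -> \bar R :=
  fun B => cond_mu a (B `*` setT).

Definition push_law (g : X -> 'I_m.+1 -> vec k.+1) (a : 'I_m.+1) :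
    set (vec k.+1) -> \bar R :=
  pushforward (muX a) (fun x => g x a).

(* f is (a version of) the Bayes regressor E[Y | X, A] with values in Delta_k *)
Definition bayes_regressor (f : X -> 'I_m.+1 -> vec k.+1) : Prop :=
  (forall a (j : 'I_k.+1), measurable_fun setT (fun x => tnth (f x a) j)) /\
  (forall x a, in_simplex (f x a)) /\
  (forall (a : 'I_m.+1) (j : 'I_k.+1) (B : set X), measurable B ->
     mu (B `*` ([set j] `*` [set a])) =
     \int[mu]_(z in B `*` (setT `*` [set a])) (tnth (f z.1 z.2.2) j)%:E).

(* A randomized classifier h : X * A -> Y given by its Markov kernel:
   H x a j = P(h(x, a) = e_j).  Err_a(h) = P(h(X, a) <> Y | A = a),
   the randomness of h being independent of (X, Y, A). *)
Definition Err (H : X -> 'I_m.+1 -> 'I_k.+1 -> R) (a : 'I_m.+1) : \bar R :=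
  \int[cond_mu a]_z (1 - H z.1 a z.2.1)%:E.

End problem.

Definition label_kernel {k : nat} (K : vec k.+1 -> 'I_k.+1 -> R) : Prop :=
  (forall j, measurable_fun setT (fun s => K s j)) /\
  (forall s j, (0 <= K s j)%R) /\
  (forall s, (\sum_(j < k.+1) K s j)%R = 1%R).

Definition disintegrates {k : nat} (p : set (vec k.+1) -> \bar R)
    (g : probability (vec k.+1 * vec k.+1)%type R)
    (K : vec k.+1 -> 'I_k.+1 -> R) : Prop :=
  forall B C : set (vec k.+1), measurable B -> measurable C ->
    g (B `*` C) = \int[p]_(s in B) (\sum_(j < k.+1 | onehot j \in C) K s j)%:E.

End defs.

(* Main.v *)
(* All costs are taken against a label e_j, where |s - e_j|_1 = 2 (1 - s_j) for s
   in the simplex; hence 2 Err_a(h) is the mean of |f^*(X, a) - h(X, a)|_1 under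
   mu_a.  Drawing the label from K_a(ftilde(X, a)) couples r^*_a with qtilde at
   that cost, which gives the lower bound.  For the upper bound, replacing f^*
   by ftilde and back changes each transport cost by at most
   D_a = E |ftilde(X, a) - f^*(X, a)|_1, so 2 sum_a Err_a exceeds
   sum_a W_1(r^*_a, q) by at most 2 sum_a D_a, for every q in Q_k. *)

Require Import Defs.
From HB Require Import structures.
From mathcomp Require Import all_boot all_order all_algebra.
From mathcomp Require Import all_classical all_reals all_analysis.
From mathcomp Require Import measurable_realfun lra.
Import Order.TTheory GRing.Theory Num.Theory.
Local Open Scope classical_set_scope.
Local Open Scope ring_scope.
Local Open Scope ereal_scope.

Set Implicit Arguments. Unset Strict Implicit. Unset Printing Implicit Defensive.

(** * Measures given by a density *)

Section density.
Context d (T : measurableType d) (R : realType).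

(** [rho] is dominated by [nu], so integrals change variables through the Radon-Nikodym derivative;
    this derivative equals [w] almost everywhere because both have the same integral over every
    measurable set. *)
Lemma integral_density (rho nu : {finite_measure set T -> \bar R})
    (w h : T -> \bar R) :
  measurable_fun setT w -> (forall x, 0 <= w x) ->
  (forall B, measurable B -> rho B = \int[nu]_(x in B) w x) ->
  measurable_fun setT h -> (forall x, 0 <= h x) ->
  \int[rho]_x h x = \int[nu]_x (h x * w x).
Proof.
move=> mw w0 rhoE mh h0.
have dom : rho `<< nu.
  apply/null_content_dominatesP => A mA nuA0; rewrite rhoE//.
  by apply: null_set_integral => //; exact: measurable_funTS.
rewrite -(Radon_Nikodym_SigmaFinite.change_of_variables dom)//.
have fi := Radon_Nikodym_SigmaFinite.f_integrable dom.
have mf := measurable_int _ fi.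
have fw : ae_eq nu setT (Radon_Nikodym_SigmaFinite.f rho nu) w.
  apply: integral_ae_eq => // E _ mE.
  by rewrite -rhoE// -Radon_Nikodym_SigmaFinite.f_integral.
apply: ae_eq_integral => //; [exact: emeasurable_funM|exact: emeasurable_funM|].
by apply: filterS fw => x + xT => ->.
Qed.

Variables (nu : {measure set T -> \bar R}) (w : T -> \bar R).
Hypotheses (mw : measurable_fun setT w) (w0 : forall x, 0 <= w x).

(* The proofs are arguments so that the measure instance can be inferred. *)
Definition mdensity of measurable_fun setT w & (forall x, 0 <= w x) :=
  fun A : set T => \int[nu]_(x in A) w x.

Local Notation mdens := (mdensity mw w0).

Let mdensity0 : mdens set0 = 0.
Proof. by rewrite /mdensity integral_set0. Qed.

Let mdensity_ge0 A : 0 <= mdens A.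
Proof. exact: integral_ge0. Qed.

Let mdensity_sigma_additive : semi_sigma_additive mdens.
Proof.
move=> F mF tF mUF; rewrite /mdensity ge0_integral_bigcup//; last first.
  exact: measurable_funTS.
by apply: is_cvg_ereal_nneg_natsum_cond => n _ _; exact: integral_ge0.
Qed.

HB.instance Definition _ := isMeasure.Build _ _ _ mdens
  mdensity0 mdensity_ge0 mdensity_sigma_additive.

End density.

(** The finite integral of [w] makes [mdensity] a finite measure, which brings it within reach of
    [integral_density]. *)
Lemma integral_mdensity d (T : measurableType d) (R : realType)
    (nu : {finite_measure set T -> \bar R}) (w h : T -> \bar R)
    (mw : measurable_fun setT w) (w0 : forall x, 0 <= w x) :
  \int[nu]_x w x < +oo -> measurable_fun setT h -> (forall x, 0 <= h x) ->
  \int[mdensity nu mw w0]_x h x = \int[nu]_x (h x * w x).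
Proof.
move=> wfin mh h0.
have fm : fin_num_fun (mdensity nu mw w0) by exact: lty_fin_num_fun.
pose rho : {finite_measure set T -> \bar R} :=
  HB.pack (mdensity nu mw w0)
    (Measure_isFinite.Build _ _ _ (mdensity nu mw w0) fm).
exact: (@integral_density _ _ _ rho nu).
Qed.

(** * Partitions up to a null set, and restrictions *)

Section partition.
Context d (T : measurableType d) (R : realType).

(** Covering up to a null set is what couplings offer: if the second marginal is in [Qk], the points
    whose second component is not a label form a null set, but not an empty one. *)
Lemma integral_ae_partition (mu : {measure set T -> \bar R}) (n : nat)
    (F : 'I_n -> set T) (h : T -> \bar R) :
  (forall i, measurable (F i)) -> trivIset setT F ->
  mu (~` \bigcup_i F i) = 0 ->
  measurable_fun setT h -> (forall x, 0 <= h x) ->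
  \int[mu]_x h x = \sum_(i < n) \int[mu]_(x in F i) h x.
Proof.
move=> mF tF; have -> : \bigcup_i F i = \big[setU/set0]_(i < n) F i.
  rewrite -bigcup_seq; congr bigcup; apply/seteqP; split=> // i _ /=.
  exact: mem_index_enum.
move=> F0 mh h0.
have mU : measurable (\big[setU/set0]_(i < n) F i) by exact: bigsetU_measurable.
rewrite (ge0_negligible_integral _ _ _ _ F0)//; last exact: measurableC.
rewrite setTD setCK ge0_integral_bigsetU//.
- by rewrite /index_enum -enumT enum_uniq.
- by apply: sub_trivIset tF.
- exact: measurable_funTS.
Qed.

Lemma measure_ae_partition (mu : {measure set T -> \bar R}) (n : nat)
    (F : 'I_n -> set T) (A : set T) :
  (forall i, measurable (F i)) -> trivIset setT F ->
  mu (~` \bigcup_i F i) = 0 -> measurable A ->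
  mu A = \sum_(i < n) mu (A `&` F i).
Proof.
move=> mF tF F0 mA.
have := @integral_ae_partition mu n F (EFin \o \1_A) mF tF F0.
rewrite /= integral_indic// setIT => ->.
- by apply: eq_bigr => i _; rewrite integral_indic.
- exact/measurable_EFinP.
- by move=> x; rewrite lee_fin.
Qed.

End partition.

(** The restriction to [D] has density [\1_D] with respect to [mu]. *)
Lemma integral_mrestr d (T : measurableType d) (R : realType)
    (mu : {finite_measure set T -> \bar R}) (D : set T)
    (mD : measurable D) (h : T -> \bar R) :
  measurable_fun setT h -> (forall x, 0 <= h x) ->
  \int[mrestr mu mD]_x h x = \int[mu]_(x in D) h x.
Proof.
move=> mh h0.
have fD : fin_num_fun (mrestr mu mD).
  by move=> A mA; rewrite /mrestr fin_num_measure//; exact: measurableI.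
pose rho : {finite_measure set T -> \bar R} :=
  HB.pack (mrestr mu mD) (Measure_isFinite.Build _ _ _ (mrestr mu mD) fD).
rewrite (@integral_density _ _ _ rho mu (EFin \o \1_D) h)//.
- by rewrite [RHS]integral_mkcond epatch_indic.
- exact/measurable_EFinP.
- by move=> x; rewrite lee_fin.
- by move=> B mB; rewrite integral_indic// setIC.
Qed.

(** * Images and slices of measures *)

Section image.
Context d1 d2 (T1 : measurableType d1) (T2 : measurableType d2) (R : realType).
Variable f : T1 -> T2.
Hypothesis mf : measurable_fun setT f.

(** The measurability proof is an argument so that the measure and finite-measure structures of the
    image can be inferred. *)
Definition mimage of measurable_fun setT f :=
  fun mu : set T1 -> \bar R => pushforward mu f.

Section measure.
Variable mu : {measure set T1 -> \bar R}.
Let mimage0 : mimage mf mu set0 = 0. Proof. exact: measure0. Qed.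
Let mimage_ge0 A : 0 <= mimage mf mu A. Proof. exact: measure_ge0. Qed.
Let mimage_sigma_additive : semi_sigma_additive (mimage mf mu).
Proof. exact: measure_semi_sigma_additive. Qed.
HB.instance Definition _ := isMeasure.Build _ _ _ (mimage mf mu)
  mimage0 mimage_ge0 mimage_sigma_additive.
End measure.

Section finite.
Variable mu : {finite_measure set T1 -> \bar R}.
Let mimage_fin : fin_num_fun (mimage mf mu).
Proof.
move=> A mA; rewrite /mimage /pushforward fin_num_measure//.
by rewrite -[_ @^-1` _]setTI; exact: mf.
Qed.
HB.instance Definition _ := Measure_isFinite.Build _ _ _ (mimage mf mu)
  mimage_fin.
End finite.

End image.

Section slice.
Context d1 d2 (T1 : measurableType d1) (T2 : measurableType d2) (R : realType).

(** The slice is the image under the first projection of [g] restricted to [setT * D]. *)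
Lemma slice_measure (g : {finite_measure set (T1 * T2)%type -> \bar R}) (D : set T2) :
  measurable D ->
  exists rho : {finite_measure set T1 -> \bar R},
    (forall B, rho B = g (B `*` D)) /\
    forall h : T1 -> \bar R, measurable_fun setT h -> (forall x, 0 <= h x) ->
      \int[rho]_x h x = \int[g]_(z in setT `*` D) h z.1.
Proof.
move=> mD; have mTD : measurable ([set: T1] `*` D) by exact: measurableX.
have fD : fin_num_fun (mrestr g mTD).
  by move=> A mA; rewrite /mrestr fin_num_measure//; exact: measurableI.
pose gD : {finite_measure set (T1 * T2)%type -> \bar R} :=
  HB.pack (mrestr g mTD) (Measure_isFinite.Build _ _ _ (mrestr g mTD) fD).
exists (mimage (@measurable_fst _ _ T1 T2) gD); split=> [B|h mh h0].
  rewrite /= /mimage /pushforward/= /mrestr; congr (g _).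
  by apply/seteqP; split=> [z [? []]|z []].
rewrite ge0_integral_pushforward// integral_mrestr//.
  exact: measurableT_comp.
by move=> x; exact: h0.
Qed.

(** With [D] the set of points carrying a fixed label, [w] is the conditional probability of that
    label. Both the transport cost and the classification error are computed this way, one label at
    a time. *)
Lemma integral_slice_density (g : {finite_measure set (T1 * T2)%type -> \bar R})
    (nu : {finite_measure set T1 -> \bar R}) (D : set T2) (w h : T1 -> \bar R) :
  measurable D -> measurable_fun setT w -> (forall x, 0 <= w x) ->
  (forall B, measurable B -> g (B `*` D) = \int[nu]_(x in B) w x) ->
  measurable_fun setT h -> (forall x, 0 <= h x) ->
  \int[g]_(z in setT `*` D) h z.1 = \int[nu]_x (h x * w x).
Proof.
move=> mD mw w0 gE mh h0; have [rho [rhoE rhoI]] := slice_measure g mD.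
rewrite -rhoI//; apply: integral_density => // B mB.
by rewrite rhoE gE.
Qed.

End slice.

(** * The l1 distance, the simplex and one-hot vectors *)

Section vec.
Context (R : realType).

Lemma l1_ge0 k (s t : @vec R k) : (0 <= l1 s t)%R.
Proof. by apply: sumr_ge0 => i _. Qed.

Lemma l1_triangle k (s t u : @vec R k) : (l1 s u <= l1 s t + l1 t u)%R.
Proof. by rewrite /l1 -big_split/=; apply: ler_sum => i _; exact: ler_distD. Qed.

Lemma l1C k (s t : @vec R k) : l1 s t = l1 t s.
Proof. by apply: eq_bigr => i _; exact: distrC. Qed.

Lemma l1_eq0 k (s t : @vec R k) : l1 s t = 0%R -> s = t.
Proof.
move=> /eqP; rewrite psumr_eq0// => /allP st0; apply: eq_from_tnth => i.
by have := st0 i (mem_index_enum i); rewrite normr_eq0 subr_eq0 => /eqP.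
Qed.

Lemma onehot_inj k : injective (@onehot R k).
Proof.
move=> i j /(congr1 (fun s : vec k => tnth s i)).
rewrite !tnth_mktuple eqxx; case: eqVneq => // _ /eqP.
by rewrite oner_eq0.
Qed.

Lemma onehot_simplex k (j : 'I_k) : in_simplex (@onehot R k j).
Proof.
split=> [i|]; first by rewrite tnth_mktuple.
under eq_bigr do rewrite tnth_mktuple.
by rewrite (bigD1 j)//= eqxx big1 ?addr0// => i /negPf; rewrite eq_sym => ->.
Qed.

(** Coordinate [j] contributes [1 - s_j], and the other coordinates, being nonnegative, contribute
    their sum, which is again [1 - s_j]. *)
Lemma l1_onehot k (s : @vec R k) (j : 'I_k) :
  in_simplex s -> l1 s (onehot j) = (2 * (1 - tnth s j))%R.
Proof.
move=> [s0 s1]; have sE := s1; rewrite (bigD1 j)//= in sE.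
have sj : (\sum_(i < k | i != j) tnth s i = 1 - tnth s j)%R.
  by rewrite -sE addrAC subrr add0r.
rewrite /l1 (bigD1 j)//= (eq_bigr (fun i => tnth s i)) => [|i ij].
  rewrite sj tnth_mktuple eqxx distrC ger0_norm; last first.
    by rewrite -sj; apply: sumr_ge0.
  by rewrite mulr_natl mulr2n.
by rewrite tnth_mktuple eq_sym (negPf ij) subr0 ger0_norm.
Qed.

Lemma l1_simplex_le2 k (s t : @vec R k) :
  in_simplex s -> in_simplex t -> (l1 s t <= 2)%R.
Proof.
move=> [s0 s1] [t0 t1].
apply: (@le_trans _ _ (\sum_(j < k) (tnth s j + tnth t j))%R).
  apply: ler_sum => j _; apply: (le_trans (ler_normB _ _)).
  by rewrite !ger0_norm.
by rewrite big_split/= s1 t1.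
Qed.

Context d (T : measurableType d).

Lemma measurable_fun_l1 k (f g : T -> @vec R k) :
  measurable_fun setT f -> measurable_fun setT g ->
  measurable_fun setT (fun x => l1 (f x) (g x)).
Proof.
move=> /measurable_fun_tnthP mf /measurable_fun_tnthP mg.
apply: measurable_sum => j; apply: measurableT_comp => //.
by apply: measurable_funB; [exact: mf|exact: mg].
Qed.

End vec.

Lemma measurable_vec1 (R : realType) k (v : @vec R k) : measurable [set v].
Proof.
(* A point is the zero set of the measurable distance to it. *)
rewrite (_ : [set v] = setT `&` (fun s => l1 s v) @^-1` [set 0%R]).
  by apply: (measurable_fun_l1 (g := cst v)) => //.
rewrite setTI; apply/seteqP; split=> [s /= ->|s /= /l1_eq0//].
by rewrite /l1 big1// => i _; rewrite subrr normr0.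
Qed.

Lemma measurable_onehot (R : realType) k (j : 'I_k) :
  measurable [set @onehot R k j].
Proof. exact: measurable_vec1. Qed.

(** * Fibers over the labels, and distributions supported on the labels *)

Section label_fibers.
Context d (T : measurableType d) (R : realType) (k : nat).

Definition label_fiber (j : 'I_k) : set (T * @vec R k)%type :=
  setT `*` [set onehot j].

Lemma measurable_label_fiber j : measurable (label_fiber j).
Proof. by apply: measurableX => //; exact: measurable_onehot. Qed.

Lemma trivIset_label_fiber : trivIset setT label_fiber.
Proof.
apply/trivIsetP => i j _ _ ij; apply/seteqP; split=> // -[x s] [] [_ /= ->] [_].
by move=> /= /onehot_inj /eqP; rewrite (negPf ij).
Qed.

Lemma measurable_Ylabels : measurable (@Ylabels R k).
Proof.
rewrite /Ylabels [X in measurable X](_ : _ =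
    \big[setU/set0]_(j < k) [set onehot j]).
  by apply: bigsetU_measurable => j _; exact: measurable_onehot.
rewrite -bigcup_seq; apply/seteqP; split=> [_ [j _ <-]|s [j _ /= ->]].
  by exists j => //=; exact: mem_index_enum.
by exists j.
Qed.

Lemma label_fiberC :
  ~` (\bigcup_j label_fiber j) = [set: T] `*` ~` (@Ylabels R k).
Proof.
apply/seteqP; split=> [[x s] /= F|[x s] /= [_ Ys] [j _ [_ /= sj]]].
  by split=> // -[j _ js]; apply: F; exists j.
by apply: Ys; exists j.
Qed.

End label_fibers.

Section Qk.
Context (R : realType) (k : nat).
Implicit Types q : probability (@vec R k) R.

Lemma Qk_YlabelsC q : q \in Qk -> q (~` (@Ylabels R k)) = 0.
Proof.
rewrite inE /Qk /= => qY; rewrite probability_setC//; last first.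
  exact: measurable_Ylabels.
by rewrite qY subee.
Qed.

(** The singletons of the labels partition the space up to a [q]-null set, so [q] is the sum of its
    atoms. *)
Lemma Qk_sum q (C : set (@vec R k)) : q \in Qk -> measurable C ->
  q C = \sum_(j < k) (\1_C (@onehot R k j))%:E * q [set onehot j].
Proof.
move=> qQ mC.
rewrite (@measure_ae_partition _ _ _ q _ (fun j => [set @onehot R k j]) C)//.
- apply: eq_bigr => j _; rewrite indicE; case: (boolP (_ \in C)) => jC.
  + rewrite mul1e; congr (q _); apply/seteqP; split=> [s []//|s /= ->].
    by split=> //; rewrite -inE.
  + rewrite mul0e (_ : _ `&` _ = set0) ?measure0//.
    apply/seteqP; split=> // s [] Cs /= sj; move: jC; rewrite -sj.
    by move/negP; apply; rewrite inE.
- by move=> j; exact: measurable_onehot.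
- apply/trivIsetP => i j _ _ ij; apply/seteqP; split=> // s [/= ->].
  by move/onehot_inj/eqP; rewrite (negPf ij).
- rewrite -(Qk_YlabelsC qQ); congr (q (~` _)).
  apply/seteqP; split=> [s [j _ /= ->]|_ [j _ <-]]; first by exists j.
  by exists j.
Qed.

End Qk.

(** * Couplings with a label distribution, kernels and transport costs *)

Section coupling.
Context (R : realType) (k : nat).
Implicit Types (p : {finite_measure set (@vec R k.+1) -> \bar R})
  (q : probability (@vec R k.+1) R)
  (g : probability (@vec R k.+1 * @vec R k.+1)%type R).

Lemma coupling_label_fiberC p q g : coupling p q g -> q \in Qk ->
  g (~` \bigcup_j @label_fiber _ (@vec R k.+1) R k.+1 j) = 0.
Proof.
move=> pqg qQ; rewrite label_fiberC.
have mY := measurableC (@measurable_Ylabels R k.+1).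
by rewrite (pqg _ mY).2 Qk_YlabelsC.
Qed.

(** Since the labels are finitely many, the conditional law is assembled from one Radon-Nikodym
    derivative per label: the slice of [g] at [onehot j] lies below the first marginal [p], hence is
    dominated by it. *)
Lemma coupling_disintegration p q g : coupling p q g -> q \in Qk ->
  exists K, label_kernel K /\
    forall j B, measurable B ->
      g (B `*` [set onehot j]) = \int[p]_(s in B) (K s j)%:E.
Proof.
move=> pqg qQ.
pose rhoP (j : 'I_k.+1) := slice_measure g (@measurable_onehot R _ j).
pose rho j := sval (cid (rhoP j)).
have rhoE j B : rho j B = g (B `*` [set onehot j]).
  by rewrite /rho; case: cid => /= r [].
have dom j : rho j `<< p.
  apply/null_content_dominatesP => A mA pA0; rewrite rhoE.
  have gA0 : g (A `*` setT) = 0 by rewrite (pqg _ mA).1.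
  apply/eqP; rewrite eq_le measure_ge0 andbT -gA0.
  apply: le_measure; rewrite ?inE; first 2 last.
  - by move=> [x y] [].
  - by apply: measurableX => //; exact: measurable_onehot.
  - exact: measurableX.
pose w j := Radon_Nikodym_SigmaFinite.f (rho j) p.
have w0 j s : 0 <= w j s by exact: Radon_Nikodym_SigmaFinite.f_ge0.
have wfin j s : w j s \is a fin_num by exact: Radon_Nikodym_SigmaFinite.f_fin_num.
have wint j : p.-integrable setT (w j).
  exact: Radon_Nikodym_SigmaFinite.f_integrable.
have mw j : measurable_fun setT (w j) by exact: measurable_int (wint j).
have wE j A : measurable A -> g (A `*` [set onehot j]) = \int[p]_(s in A) w j s.
  by move=> mA; rewrite -rhoE; exact: Radon_Nikodym_SigmaFinite.f_integral.
(* Over a measurable [E], the derivatives integrate to the [g]-masses of [E] times each label; these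
   add up to [g (E * setT) = p E], as [g] charges only the label fibers. *)
have sum1 : ae_eq p setT (fun s => \sum_(j < k.+1) w j s) (cst 1).
  apply: integral_ae_eq => //.
    by apply: integrable_sum => // j _; exact: wint.
  move=> E _ mE; rewrite integral_cst// mul1e ge0_integral_sum//; last first.
    by move=> j; exact: measurable_funTS.
  transitivity (g (E `*` setT)); last exact: (pqg _ mE).1.
  rewrite (@measure_ae_partition _ _ _ g _ (@label_fiber _ _ R k.+1))//; last 4 first.
  - exact: measurable_label_fiber.
  - exact: trivIset_label_fiber.
  - exact: coupling_label_fiberC pqg qQ.
  - exact: measurableX.
  apply: eq_bigr => j _; rewrite -wE//; congr (g _).
  by apply/seteqP; split=> [[x y] []//|[x y] [[? _] []]].
pose S s := (\sum_(j < k.+1) fine (w j s))%R.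
(* On the [p]-null set where the derivatives do not sum to 1, the point mass at label [ord0] is
   used, so that [K] is a kernel at every point. *)
pose K s j := if S s == 1%R then fine (w j s) else (j == ord0)%:R%R.
have mfw j : measurable_fun setT (fun s => fine (w j s)).
  exact: measurableT_comp.
have SE s : (S s)%:E = \sum_(j < k.+1) w j s.
  by rewrite /S -sumEFin; apply: eq_bigr => j _; rewrite fineK.
have mK j : measurable_fun setT (K ^~ j).
  apply: measurable_fun_ifT => //.
  apply: measurable_fun_eqr => //; exact: measurable_sum.
exists K; split; first split; [|split|] => //.
- by move=> s j; rewrite /K; case: ifP => // _; exact: fine_ge0.
- move=> s; rewrite /K; case: (eqVneq (S s) 1%R) => [//|_].
  by rewrite (bigD1 ord0)//= big1 ?addr0// => j /negPf ->.
- move=> j B mB; rewrite wE//; apply: ae_eq_integral => //.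
  + exact: measurable_funTS.
  + exact/measurable_EFinP/measurable_funTS.
  + apply: filterS sum1 => s + _ => /(_ Logic.I); rewrite -SE /K => -[->].
    by rewrite eqxx fineK.
Qed.

(** On the fiber of label [j] the cost depends on the first component only, and there [g] has
    density [K s j] with respect to [p]; the fibers are then summed. *)
Lemma coupling_cost p q g K : coupling p q g -> q \in Qk -> label_kernel K ->
  (forall j B, measurable B ->
      g (B `*` [set onehot j]) = \int[p]_(s in B) (K s j)%:E) ->
  \int[g]_z (l1 z.1 z.2)%:E =
  \int[p]_s (\sum_(j < k.+1) K s j * l1 s (onehot j))%:E.
Proof.
move=> pqg qQ [mK [K0 K1]] gE.
rewrite (@integral_ae_partition _ _ _ g _ (@label_fiber _ _ R k.+1)); last 5 first.
- exact: measurable_label_fiber.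
- exact: trivIset_label_fiber.
- exact: coupling_label_fiberC pqg qQ.
- exact/measurable_EFinP/measurable_fun_l1.
- by move=> z; rewrite lee_fin l1_ge0.
have ml j : measurable_fun setT (fun s : @vec R k.+1 => (l1 s (onehot j))%:E).
  by apply/measurable_EFinP/measurable_fun_l1.
transitivity (\sum_(j < k.+1) \int[p]_s ((l1 s (onehot j))%:E * (K s j)%:E)).
  apply: eq_bigr => j _.
  rewrite -(@integral_slice_density _ _ _ _ _ g p [set onehot j])//.
  - by apply: eq_integral => -[s t]; rewrite inE => -[_ /= ->].
  - exact: measurable_onehot.
  - exact/measurable_EFinP.
  - by move=> s; rewrite lee_fin.
  - by move=> B mB; exact: gE.
  - by move=> s; rewrite lee_fin l1_ge0.
rewrite -ge0_integral_sum//.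
- apply: eq_integral => s _; rewrite -sumEFin; apply: eq_bigr => j _.
  by rewrite EFinM muleC.
- by move=> j; apply: emeasurable_funM => //; exact/measurable_EFinP.
- by move=> j s _; rewrite -EFinM lee_fin mulr_ge0// l1_ge0.
Qed.

(** The plan that witnesses the bound is the law of [(f x, onehot j)], with [x] drawn from [nu] and
    then [j] from [kap x]. *)
Lemma W1_kernel_le d (X : measurableType d)
    (nu : {finite_measure set X -> \bar R}) (f : X -> @vec R k.+1)
    (kap : X -> 'I_k.+1 -> R) q :
  measurable_fun setT f -> q \in Qk ->
  (forall j, measurable_fun setT (kap ^~ j)) ->
  (forall x j, (0 <= kap x j)%R) -> (forall x, \sum_(j < k.+1) kap x j = 1)%R ->
  (forall j, q [set onehot j] = \int[nu]_x (kap x j)%:E) ->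
  W1 (pushforward nu f) q <=
  \int[nu]_x (\sum_(j < k.+1) kap x j * l1 (f x) (onehot j))%:E.
Proof.
move=> mf qQ mkap kap0 kap1 qE.
have mw j : measurable_fun setT (fun x => (kap x j)%:E).
  exact/measurable_EFinP.
have w0 j x : 0 <= (kap x j)%:E by rewrite lee_fin.
have mphi j : measurable_fun setT (fun x => (f x, @onehot R k.+1 j)).
  exact: measurable_fun_pair.
(* The part of the plan with label [j] is [nu] weighted by [kap x j] and sent to [(f x, onehot j)].
   [msum] takes families indexed by naturals, hence [inord]. *)
pose m_ n : {measure set (@vec R k.+1 * @vec R k.+1)%type -> \bar R} :=
  mimage (mphi (inord n)) (mdensity nu (mw (inord n)) (w0 (inord n))).
have gE A : msum m_ k.+1 A =
    \sum_(j < k.+1) \int[nu]_(x in (fun x => (f x, onehot j)) @^-1` A)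
      (kap x j)%:E.
  by rewrite /msum; apply: eq_bigr => j _; rewrite /m_ /= inord_val.
have gcoup A : measurable A -> msum m_ k.+1 (A `*` setT) = pushforward nu f A /\
    msum m_ k.+1 (setT `*` A) = q A.
  move=> mA; have mfA : measurable (f @^-1` A).
    by rewrite -[X in measurable X]setTI; exact: mf.
  rewrite !gE; split.
    transitivity (\sum_(j < k.+1) \int[nu]_(x in f @^-1` A) (kap x j)%:E).
      apply: eq_bigr => j _; congr (integral nu _ _).
      by apply/seteqP; split=> [x []|].
    rewrite -ge0_integral_sum//; last by move=> j; exact: measurable_funTS.
    under eq_integral do rewrite sumEFin kap1.
    by rewrite integral_cst// mul1e.
  rewrite (Qk_sum qQ mA); apply: eq_bigr => j _; rewrite indicE.
  case: (boolP (_ \in A)) => jA.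
    rewrite mul1e qE; congr (integral nu _ _).
    by apply/seteqP; split=> // x _; split=> //; rewrite inE in jA.
  rewrite mul0e (_ : _ @^-1` _ = set0) ?integral_set0//.
  apply/seteqP; split=> // x [_ /=]; move: jA; rewrite notin_setE.
  by apply.
(* The mass is read off the second marginal [q], since [nu] is only assumed finite. *)
have g1 : msum m_ k.+1 setT = 1.
  by rewrite -setXTT (gcoup setT measurableT).2 probability_setT.
pose g : probability (@vec R k.+1 * @vec R k.+1)%type R :=
  HB.pack (msum m_ k.+1) (Measure_isProbability.Build _ _ _ (msum m_ k.+1) g1).
apply: (@le_trans _ _ (\int[g]_z (l1 z.1 z.2)%:E)).
  by apply: ereal_inf_lbound; exists g.
have ml1 : measurable_fun setT
    (fun z : @vec R k.+1 * @vec R k.+1 => (l1 z.1 z.2)%:E).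
  exact/measurable_EFinP/measurable_fun_l1.
have l10 (z : @vec R k.+1 * @vec R k.+1) : 0 <= (l1 z.1 z.2)%:E.
  by rewrite lee_fin l1_ge0.
rewrite (ge0_integral_measure_sum m_)//.
have ml j : measurable_fun setT (fun x => (l1 (f x) (@onehot R k.+1 j))%:E).
  by apply/measurable_EFinP/measurable_fun_l1.
under eq_integral do rewrite -sumEFin.
rewrite ge0_integral_sum//; last 2 first.
- move=> j; apply/measurable_EFinP/measurable_funM => //.
  exact: measurable_fun_l1.
- by move=> j x _; rewrite lee_fin mulr_ge0// l1_ge0.
apply: lee_sum => j _; rewrite /m_ inord_val /= /mimage ge0_integral_pushforward//.
rewrite preimage_setT integral_mdensity//.
- by under eq_integral do rewrite /= -EFinM mulrC.
- by rewrite -qE (le_lt_trans (probability_le1 _ _)) ?ltry//; exact: measurable_onehot.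
- exact: ml.
- by move=> x; rewrite lee_fin l1_ge0.
Qed.

(** The triangle inequality is averaged with the weights [kap x j]; as they sum to 1, the term
    [l1 (f x) (g x)] comes out unweighted. *)
Lemma kernel_cost_triangle d (X : measurableType d)
    (nu : {finite_measure set X -> \bar R}) (f g : X -> @vec R k.+1)
    (kap : X -> 'I_k.+1 -> R) :
  measurable_fun setT f -> measurable_fun setT g ->
  (forall j, measurable_fun setT (kap ^~ j)) ->
  (forall x j, (0 <= kap x j)%R) -> (forall x, \sum_(j < k.+1) kap x j = 1)%R ->
  \int[nu]_x (\sum_(j < k.+1) kap x j * l1 (f x) (onehot j))%:E <=
  \int[nu]_x (l1 (f x) (g x))%:E +
  \int[nu]_x (\sum_(j < k.+1) kap x j * l1 (g x) (onehot j))%:E.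
Proof.
move=> mf mg mkap kap0 kap1.
have cost0 h x : (0 <= \sum_(j < k.+1) kap x j * l1 h (@onehot R k.+1 j))%R.
  by apply: sumr_ge0 => j _; rewrite mulr_ge0// l1_ge0.
have mcost (h : X -> @vec R k.+1) : measurable_fun setT h ->
    measurable_fun setT
      (fun x => (\sum_(j < k.+1) kap x j * l1 (h x) (onehot j))%:E).
  move=> mh; apply/measurable_EFinP/measurable_sum => j.
  by apply: measurable_funM => //; exact: measurable_fun_l1.
have mfg : measurable_fun setT (fun x => (l1 (f x) (g x))%:E).
  exact/measurable_EFinP/measurable_fun_l1.
rewrite -ge0_integralD//.
- apply: ge0_le_integral => //.
  + by move=> x _; rewrite lee_fin.
  + exact: mcost.
  + by apply: emeasurable_funD => //; exact: mcost.
  + move=> x _; rewrite -EFinD lee_fin.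
    rewrite -[X in (_ <= X + _)%R]mul1r -(kap1 x) mulr_suml -big_split/=.
    by apply: ler_sum => j _; rewrite -mulrDr ler_wpM2l// l1_triangle.
- by move=> x _; rewrite lee_fin l1_ge0.
- by move=> x _; rewrite lee_fin.
- exact: mcost.
Qed.

(* The second plan is moved along [g x |-> f x], keeping the conditional law of
   the label; this replaces the gluing lemma in the triangle inequality. *)
Lemma W1_Qk_triangle d (X : measurableType d)
    (nu : {finite_measure set X -> \bar R}) (f g : X -> @vec R k.+1) q :
  measurable_fun setT f -> measurable_fun setT g -> q \in Qk ->
  \int[nu]_x (l1 (f x) (g x))%:E < +oo ->
  W1 (pushforward nu f) q <=
  \int[nu]_x (l1 (f x) (g x))%:E + W1 (pushforward nu g) q.
Proof.
move=> mf mg qQ fgfin.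
have Dfin : \int[nu]_x (l1 (f x) (g x))%:E \is a fin_num.
  by rewrite ge0_fin_numE//; apply: integral_ge0 => x _; rewrite lee_fin l1_ge0.
(* Finiteness of the distance term lets it move to the left, after which the infimum on the right is
   bounded plan by plan. *)
rewrite -leeBlDl//; apply/ereal_infP => _ [gam gamP <-].
rewrite leeBlDl//.
have pqg : coupling (mimage mg nu) q gam by [].
have [K [Kker gamE]] := coupling_disintegration pqg qQ.
have [mK [K0 K1]] := Kker.
have mKg j : measurable_fun setT (fun x => K (g x) j).
  exact: (measurableT_comp (mK j)).
rewrite (coupling_cost pqg qQ Kker gamE) ge0_integral_pushforward//; last 2 first.
- apply/measurable_EFinP/measurable_sum => j.
  by apply: measurable_funM => //; exact: measurable_fun_l1.
- by move=> s _; rewrite lee_fin; apply: sumr_ge0 => j _; rewrite mulr_ge0// l1_ge0.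
apply: le_trans (kernel_cost_triangle nu mf mg mKg _ _) => //.
apply: W1_kernel_le => // j.
have mj := @measurable_onehot R _ j.
rewrite -(pqg _ mj).2 gamE// ge0_integral_pushforward//.
- exact/measurable_EFinP.
- by move=> s _; rewrite lee_fin.
Qed.

End coupling.

(** * Conditional laws given the group, and the error as a transport cost *)

Section problem.
Context (R : realType) d (X : measurableType d) (k m : nat).
Variable mu : probability (X * ('I_k.+1 * 'I_m.+1))%type R.
Variable a : 'I_m.+1.
Hypothesis a0 : 0 < mu (eventA a).

Lemma measurable_eventA : measurable (@eventA _ X k m a).
Proof.
rewrite (_ : eventA a = setT `*` (setT `*` [set a])).
  by do 2 apply: measurableX => //.
by apply/seteqP; split=> [[x [j b]] //=|[x [j b]] /= [_ [_]]].
Qed.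

(** [cond_mu] and [muX] are bare set functions; they are realized here as finite measures, the
    normalized restriction of [mu] and its first marginal, so that integration lemmas apply to
    them. *)
Lemma conditional_laws :
  exists (c : {finite_measure set (X * ('I_k.+1 * 'I_m.+1))%type -> \bar R})
    (nu : {finite_measure set X -> \bar R}),
  [/\ (c : set _ -> \bar R) = cond_mu mu a,
      (nu : set _ -> \bar R) = muX mu a,
      nu setT = 1,
      forall h, measurable_fun setT h -> (forall z, 0 <= h z) ->
        \int[c]_z h z = (fine (mu (eventA a)))^-1%:E * \int[mu]_(z in eventA a) h z &
      forall h, measurable_fun setT h -> (forall x, 0 <= h x) ->
        \int[nu]_x h x = \int[c]_z h z.1].
Proof.
have mE := measurable_eventA.
have r0 : (0 <= (fine (mu (eventA a)))^-1)%R by rewrite invr_ge0 fine_ge0.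
pose ms := mscale (NngNum r0) (mrestr mu mE).
have fm : fin_num_fun ms.
  by move=> A mA; rewrite /ms /mscale /mrestr fin_numM// fin_num_measure.
pose c : {finite_measure set (X * ('I_k.+1 * 'I_m.+1))%type -> \bar R} :=
  HB.pack (mscale (NngNum r0) (mrestr mu mE))
    (Measure_isFinite.Build _ _ _ (mscale (NngNum r0) (mrestr mu mE)) fm).
have cE : (c : set _ -> \bar R) = cond_mu mu a.
  by apply/funext => B; rewrite /= /mscale /mrestr/= muleC.
have nuE : (mimage (@measurable_fst _ _ X _) c : set _ -> \bar R) = muX mu a.
  apply/funext => B; rewrite /mimage /pushforward/= cE /muX; congr (cond_mu _ _ _).
  by apply/seteqP; split=> [x|x []].
exists c, (mimage (@measurable_fst _ _ X _) c); split=> //.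
- rewrite [LHS](congr1 (fun n : set X -> \bar R => n setT) nuE).
  rewrite /muX /cond_mu setXTT setTI muleC -[X in _ * X]fineK ?fin_num_measure// -EFinM mulVf//.
  by rewrite gt_eqF// fine_gt0// a0 /= ltey_eq fin_num_measure.
- move=> h mh h0; rewrite /= ge0_integral_mscale//.
  by rewrite integral_mrestr.
- by move=> h mh h0; rewrite /= /mimage ge0_integral_pushforward.
Qed.

Variable f : X -> 'I_m.+1 -> @vec R k.+1.
Hypothesis fB : bayes_regressor mu f.

(** Both sides carry the factor [1 / mu (eventA a)]; without it, this is the defining identity of
    the regressor on the group [a]. *)
Lemma bayes_regressor_cond (nu : {finite_measure set X -> \bar R}) j B :
  (nu : set X -> \bar R) = muX mu a -> measurable B ->
  cond_mu mu a (B `*` ([set j] `*` setT)) =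
  \int[nu]_(x in B) (tnth (f x a) j)%:E.
Proof.
move=> nuE mB; have [c [nu' [cE nu'E _ cI nuI]]] := conditional_laws.
have [mf [fS fE]] := fB.
have {nuE nu'E} -> : \int[nu]_(x in B) (tnth (f x a) j)%:E =
    \int[nu']_(x in B) (tnth (f x a) j)%:E.
  by rewrite nuE nu'E.
have mFB : measurable_fun setT ((fun x => (tnth (f x a) j)%:E) \_ B).
  apply/measurable_restrict => //; first by apply/measurable_EFinP/measurable_funTS.
have FB0 x : 0 <= ((fun x => (tnth (f x a) j)%:E) \_ B) x.
  by rewrite patchE; case: ifP => // _; rewrite lee_fin; case: (fS x a).
rewrite integral_mkcond nuI// cI//; last first.
  exact: (measurableT_comp mFB).
rewrite /cond_mu muleC; congr (_ * _).
rewrite (_ : _ `&` _ = B `*` ([set j] `*` [set a])); last first.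
  apply/seteqP; split=> -[x [i b]]; rewrite /eventA /=.
    by move=> [[Bx [-> _]] ->].
  by move=> [Bx [-> ->]].
rewrite fE// (_ : B `*` (setT `*` [set a]) = eventA a `&` (B `*` setT)).
  rewrite integral_mkcondr; apply: eq_integral => -[x [i b]]; rewrite inE /=.
  rewrite /eventA/= => ->; rewrite !patchE /=.
  by congr (if _ then _ else _); apply/idP/idP; rewrite !inE => // -[].
apply/seteqP; split=> -[x [i b]]; rewrite /eventA /=.
  by move=> [Bx [_ ->]].
by move=> [-> []].
Qed.

(** Conditioning on the label turns the error into the mean of [sum_j (1 - H_j) f_j]. By
    [l1_onehot], half the cost is the mean of [sum_j H_j (1 - f_j)]. Both integrands equal
    [1 - sum_j H_j f_j], because [f] and [H] each sum to 1. *)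
Lemma Err_cost (H : X -> 'I_m.+1 -> 'I_k.+1 -> R) :
  (forall j, measurable_fun setT (fun x => H x a j)) ->
  (forall x j, (0 <= H x a j)%R) -> (forall x, \sum_(j < k.+1) H x a j = 1)%R ->
  Err mu H a = (2^-1)%:E *
    \int[muX mu a]_x (\sum_(j < k.+1) H x a j * l1 (f x a) (onehot j))%:E.
Proof.
move=> mH H0 H1; have [c [nu [cE nuE _ _ nuI]]] := conditional_laws.
have [mf [fS _]] := fB.
have H_le1 x j : (H x a j <= 1)%R.
  by rewrite -(H1 x) (bigD1 j)//= lerDl sumr_ge0.
have mH1 j : measurable_fun setT (fun x => (1 - H x a j)%:E).
  by apply/measurable_EFinP/measurable_funB.
pose F (j : 'I_k.+1) : set (X * ('I_k.+1 * 'I_m.+1)) :=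
  setT `*` ([set j] `*` setT).
have mF j : measurable (F j) by do 2 apply: measurableX => //.
have mG : measurable_fun setT
    (fun z : X * ('I_k.+1 * 'I_m.+1) => (1 - H z.1 a z.2.1)%:E).
  apply/measurable_EFinP/measurable_funB => //.
  (* The label also varies with [z], so measurability is obtained by expanding over its finitely
     many values. *)
  rewrite (_ : (fun z => _) =
      fun z => (\sum_(j < k.+1) H z.1 a j * \1_(F j) z)%R).
    apply: measurable_sum => j; apply: measurable_funM.
      exact: (measurableT_comp (mH j)).
    exact: measurable_indic.
  apply/funext => -[x [l b]]; rewrite (bigD1 l)//= big1 => [|j jl].
    by rewrite addr0 indicE mem_set ?mulr1.
  rewrite indicE memNset ?mulr0// => -[_ [/= lj _]].
  by rewrite lj eqxx in jl.
rewrite /Err -cE (@integral_ae_partition _ _ _ c _ F)//; last 3 first.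
- apply/trivIsetP => i j _ _ ij; apply/seteqP; split=> // -[x [l b]].
  by move=> [] [_ [/= -> _]] [_ [/= /eqP]]; rewrite (negPf ij).
- rewrite (_ : ~` _ = set0) ?measure0//; apply/seteqP; split=> // -[x [l b]] /=.
  by apply; exists l.
- by move=> z; rewrite lee_fin subr_ge0.
transitivity (\sum_(j < k.+1)
    \int[nu]_x ((1 - H x a j)%:E * (tnth (f x a) j)%:E)).
  apply: eq_bigr => j _.
  rewrite -(@integral_slice_density _ _ _ _ _ c nu ([set j] `*` setT))//.
  - by apply: eq_integral => -[x [l b]]; rewrite inE => -[_ [/= -> _]].
  - by apply: measurableX.
  - by apply/measurable_EFinP.
  - by move=> x; rewrite lee_fin; case: (fS x a).
  - by move=> B mB; rewrite cE; exact: bayes_regressor_cond.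
  - by move=> x; rewrite lee_fin subr_ge0.
have mcost : measurable_fun setT
    (fun x => (\sum_(j < k.+1) H x a j * l1 (f x a) (onehot j))%:E).
  apply/measurable_EFinP/measurable_sum => j; apply: measurable_funM => //.
  by apply: measurable_fun_l1 => //; apply/measurable_fun_tnthP => i; exact: mf.
rewrite -nuE -ge0_integralZl//; last first.
  by move=> x _; rewrite lee_fin; apply: sumr_ge0 => j _; rewrite mulr_ge0// l1_ge0.
rewrite -ge0_integral_sum//; last 2 first.
- by move=> j; apply: emeasurable_funM => //; apply/measurable_EFinP.
- move=> j x _; rewrite -EFinM lee_fin mulr_ge0 ?subr_ge0//.
  by case: (fS x a).
apply: eq_integral => x _; under eq_bigr do rewrite -EFinM mulrBl mul1r.
rewrite sumEFin -EFinM; congr EFin; rewrite mulr_sumr.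
under [RHS]eq_bigr => j _ do rewrite l1_onehot// mulrCA mulKf ?pnatr_eq0// mulrBr mulr1.
by rewrite !sumrB (H1 x) (fS x a).2.
Qed.

End problem.

(** * The two bounds on the excess error *)

(* k.+2 classes (k >= 2 in the paper), m.+1 groups (A = [m], m >= 1). *)
Theorem theorem3p4 (R : realType) (d : measure_display) (X : measurableType d)
  (k m : nat)
  (mu : probability (X * ('I_k.+2 * 'I_m.+1))%type R)
  (fstar ftilde : X -> 'I_m.+1 -> @vec R k.+2)
  (qtilde : probability (@vec R k.+2) R)
  (gtilde : 'I_m.+1 -> probability (@vec R k.+2 * @vec R k.+2)%type R)
  (K : 'I_m.+1 -> @vec R k.+2 -> 'I_k.+2 -> R) :
  @standard_borel R d X ->
  (forall a, 0 < mu (eventA a)) ->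
  bayes_regressor mu fstar ->
  (forall a, measurable_fun setT (fun x => ftilde x a)) ->
  (forall x a, in_simplex (ftilde x a)) ->
  qtilde \in Qk ->
  (forall q, q \in Qk ->
     \sum_(a < m.+1) W1 (push_law mu ftilde a) qtilde
       <= \sum_(a < m.+1) W1 (push_law mu ftilde a) q) ->
  (forall a, coupling (push_law mu ftilde a) qtilde (gtilde a)) ->
  (forall a, \int[gtilde a]_z (l1 z.1 z.2)%:E
               = W1 (push_law mu ftilde a) qtilde) ->
  (forall a, label_kernel (K a)) ->
  (forall a, disintegrates (push_law mu ftilde a) (gtilde a) (K a)) ->
  let Err_star := (2^-1)%:E *
      ereal_inf [set \sum_(a < m.+1) W1 (push_law mu fstar a) q | q in Qk] in
  let hbar := fun x a j => K a (ftilde x a) j in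
  0 <= \sum_(a < m.+1) Err mu hbar a - Err_star /\
  \sum_(a < m.+1) Err mu hbar a - Err_star
    <= \sum_(a < m.+1) \int[muX mu a]_x (l1 (ftilde x a) (fstar x a))%:E.
Proof.
move=> _ mu0 fB mft ftS qQ qmin gP gcost Kker Kg Err_star hbar.
have [mf [fS _]] := fB.
have /choice[nu nuP] (a : 'I_m.+1) : exists nu : {finite_measure set X -> \bar R},
    (nu : set X -> \bar R) = muX mu a /\ nu setT = 1.
  by have [c [nu [_ nuE nu1 _ _]]] := conditional_laws (mu0 a); exists nu.
have nuE a : (nu a : set X -> \bar R) = muX mu a by case: (nuP a).
have pE a : push_law mu ftilde a = mimage (mft a) (nu a).
  by rewrite /push_law /mimage -nuE.
have mfs a : measurable_fun setT (fun x => fstar x a).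
  by apply/measurable_fun_tnthP => j; exact: mf.
pose D a := \int[muX mu a]_x (l1 (ftilde x a) (fstar x a))%:E.
(* [C a] is the cost of sending [fstar] to the label drawn by [hbar], that is, twice the error on
   group [a]. *)
pose C a := \int[muX mu a]_x
  (\sum_(j < k.+2) hbar x a j * l1 (fstar x a) (onehot j))%:E.
have mK a j : measurable_fun setT (fun x => hbar x a j).
  by apply: (measurableT_comp ((Kker a).1 j)).
have K0 a x j : (0 <= hbar x a j)%R by exact: (Kker a).2.1.
have K1 a x : (\sum_(j < k.+2) hbar x a j = 1)%R by exact: (Kker a).2.2.
have ErrE a : Err mu hbar a = (2^-1)%:E * C a by exact: Err_cost.
have D0 a : 0 <= D a.
  by rewrite /D -nuE; apply: integral_ge0 => x _; rewrite lee_fin l1_ge0.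
(* The bound 2 is the l1 diameter of the simplex, and [muX mu a] has mass 1. *)
have int_lty a (h : X -> R) : measurable_fun setT h ->
    (forall x, (0 <= h x <= 2)%R) -> \int[muX mu a]_x (h x)%:E < +oo.
  move=> mh h02; rewrite -nuE.
  apply: (@le_lt_trans _ _ (\int[nu a]_x (cst 2%:E x))).
    apply: ge0_le_integral => //.
    - by move=> x _; rewrite lee_fin; case/andP: (h02 x).
    - exact/measurable_EFinP.
    - by move=> x _; rewrite lee_fin; case/andP: (h02 x).
  rewrite integral_cst// [X in _ * X](_ : _ = 1) ?mule1 ?ltry//.
  exact: (nuP a).2.
have Dfin a : D a < +oo.
  apply: int_lty => [|x]; first exact: measurable_fun_l1.
  by rewrite l1_ge0 l1_simplex_le2.
have Cfin a : C a < +oo.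
  apply: int_lty => [|x].
    apply: measurable_sum => j; apply: measurable_funM => //.
    exact: measurable_fun_l1.
  apply/andP; split.
    by apply: sumr_ge0 => j _; rewrite mulr_ge0// l1_ge0.
  rewrite -[leRHS]mul1r -[X in (_ <= X * _)%R](K1 a x) mulr_suml; apply: ler_sum => j _.
  by rewrite ler_wpM2l// l1_simplex_le2//; exact: onehot_simplex.
(* Taking a single label as the second set in [disintegrates] leaves one term of the sum, by
   injectivity of [onehot]. *)
have KE a j B : measurable B -> gtilde a (B `*` [set onehot j]) =
    \int[push_law mu ftilde a]_(s in B) (K a s j)%:E.
  move=> mB; rewrite (Kg a)//; last exact: measurable_onehot.
  rewrite pE; apply: eq_integral => s _; rewrite (bigD1 j) ?inE//= big1 ?addr0// => i.
  by case/andP; rewrite inE /= => /onehot_inj ->; rewrite eqxx.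
have W1_ge0 (p : set (@vec R k.+2) -> \bar R) q : 0 <= W1 p q.
  apply/ereal_infP => _ [g _ <-]; apply: integral_ge0 => z _.
  by rewrite lee_fin l1_ge0.
have C0 a : 0 <= C a.
  rewrite /C -nuE; apply: integral_ge0 => x _; rewrite lee_fin; apply: sumr_ge0 => j _.
  by rewrite mulr_ge0// l1_ge0.
(* The labels drawn by [hbar] have law [qtilde], the second marginal of [gtilde a], so pairing them
   with [fstar] is an admissible plan. *)
have W1_le_C a : W1 (push_law mu fstar a) qtilde <= C a.
  rewrite /push_law /C -nuE; apply: W1_kernel_le => // j.
  have mj := @measurable_onehot R _ j.
  rewrite -(gP a _ mj).2 KE// /push_law -nuE ge0_integral_pushforward//.
  - by apply/measurable_EFinP; exact: (Kker a).1.
  - by move=> s _; rewrite lee_fin; exact: (Kker a).2.1.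
(* Replacing [fstar] by [ftilde] costs at most [D a]; what remains is the cost of [gtilde a], which
   is optimal. *)
have C_le a : C a <= D a + W1 (push_law mu ftilde a) qtilde.
  rewrite -gcost /C.
  have pqg : coupling (mimage (mft a) (nu a)) qtilde (gtilde a).
    by move=> A mA; have := gP a A mA; rewrite /push_law -nuE.
  rewrite (coupling_cost pqg qQ (Kker a)); last first.
    by move=> j B mB; rewrite KE// /push_law -nuE.
  rewrite ge0_integral_pushforward//; last 2 first.
  - apply/measurable_EFinP/measurable_sum => j; apply: measurable_funM.
      exact: (Kker a).1.
    exact: measurable_fun_l1.
  - move=> s _; rewrite lee_fin; apply: sumr_ge0 => j _.
    by rewrite mulr_ge0 ?l1_ge0//; exact: (Kker a).2.1.
  rewrite /D -nuE; under [X in X + _]eq_integral do rewrite l1C.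
  exact: kernel_cost_triangle.
have W1_triangle a q : q \in Qk ->
    W1 (push_law mu ftilde a) q <= D a + W1 (push_law mu fstar a) q.
  move=> qq; have := Dfin a; rewrite /D /push_law -nuE => Dnu.
  exact: W1_Qk_triangle.
set I := ereal_inf _ in Err_star *.
have sumErr : \sum_(a < m.+1) Err mu hbar a = (2^-1)%:E * \sum_(a < m.+1) C a.
  by under eq_bigr do rewrite ErrE; rewrite ge0_sume_distrr.
have I_le_C : I <= \sum_(a < m.+1) C a.
  apply: (@le_trans _ _ (\sum_(a < m.+1) W1 (push_law mu fstar a) qtilde)).
    by apply: ereal_inf_lbound; exists qtilde => //; rewrite inE in qQ.
  by apply: lee_sum => a _.
have sumDfin : \sum_(a < m.+1) D a \is a fin_num.
  by apply/sum_fin_numP => a _ _; rewrite ge0_fin_numE.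
have I_ge0 : 0 <= I.
  by apply/ereal_infP => _ [q _ <-]; apply: sume_ge0.
(* For each [q], one sum of [D] pays for passing from [fstar] to [ftilde]. Minimality of [qtilde]
   then replaces it by [q], and the second sum of [D] pays for returning to [fstar]. *)
have C_le_I : \sum_(a < m.+1) C a <=
    \sum_(a < m.+1) D a + \sum_(a < m.+1) D a + I.
  rewrite -leeBlDl ?fin_numD ?sumDfin//; apply/ereal_infP => _ [q qq <-].
  have {}qq : q \in Qk by rewrite inE.
  rewrite leeBlDl ?fin_numD ?sumDfin//.
  apply: (@le_trans _ _ (\sum_(a < m.+1) D a +
      \sum_(a < m.+1) W1 (push_law mu ftilde a) qtilde)).
    by rewrite -big_split/=; apply: lee_sum.
  rewrite -addeA leeD2l//; apply: (le_trans (qmin q qq)).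
  by rewrite -big_split/=; apply: lee_sum => a _; exact: W1_triangle.
have sumC0 : 0 <= \sum_(a < m.+1) C a by apply: sume_ge0.
rewrite sumErr /Err_star {Err_star}.
change (\sum_(a < m.+1) \int[muX mu a]_x (l1 (ftilde x a) (fstar x a))%:E)
  with (\sum_(a < m.+1) D a).
have : \sum_(a < m.+1) C a \is a fin_num.
  by apply/sum_fin_numP => a _ _; rewrite ge0_fin_numE.
move: sumDfin I_ge0 I_le_C C_le_I sumC0.
have : 0 <= \sum_(a < m.+1) D a by apply: sume_ge0.
(* The sums of [C] and [D] are finite and [I] lies between 0 and the sum of [C], so only real values
   remain; the factor one half then turns two sums of [D] into one. *)
case: (\sum_(a < m.+1) D a) => [D'| |]//.
case: (\sum_(a < m.+1) C a) => [C'| |]; case: I => [I'| |]//.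
rewrite -?(EFinM, EFinD, EFinB) !lee_fin => *.
by split; lra.
Qed.
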